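(* (i) For every $n>3$, every ortholattice satisfying the $n$OA law satisfies the $(n-1)$OA law. (ii) For each $n\in\{3,4,5\}$, there is an ortholattice (indeed a finite orthomodular lattice) satisfying the $n$OA law but not the $(n+1)$OA law.
   Context: An ortholattice (OL) is a bounded lattice with an operation $'$ satisfying $a''=a$, $a\le b\Rightarrow b'\le a'$, $a\cap a'=0$ and $a\cup a'=1$. An orthomodular lattice is an OL in which $a\le b$ implies $b=a\cup(a'\cap b)$. Write $a\to b=a'\cup(a\cap b)$. The operation $\overset{(n)}{\equiv}$ is defined by $$a_1\overset{(3)}{\equiv}a_2=((a_1\to a_3)\cap(a_2\to a_3))\cup((a_1'\to a_3)\cap(a_2'\to a_3)),$$ $$a_1\overset{(n)}{\equiv}a_2=(a_1\overset{(n-1)}{\equiv}a_2)\cup((a_1\overset{(n-1)}{\equiv}a_n)\cap(a_2\overset{(n-1)}{\equiv}a_n))\quad (n\ge4).$$ In each $(n-1)$-level subexpression only the two displayed variables are substituted; $a_3$ stays fixed. The $n$OA law is $(a_1\to a_3)\cap(a_1\overset{(n)}{\equiv}a_2)\le a_2\to a_3$, required for all $a_1,\dots,a_n$. *)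

(* Defs.v *)
From Stdlib Require Import List.

Record ortholattice := OL {
  car :> Type;
  meet : car -> car -> car;
  join : car -> car -> car;
  compl : car -> car;
  zero : car;
  one : car;
  meetC : forall a b, meet a b = meet b a;
  joinC : forall a b, join a b = join b a;
  meetA : forall a b c, meet a (meet b c) = meet (meet a b) c;
  joinA : forall a b c, join a (join b c) = join (join a b) c;
  meet_absorb : forall a b, meet a (join a b) = a;
  join_absorb : forall a b, join a (meet a b) = a;
  meet0 : forall a, meet zero a = zero;
  join1 : forall a, join one a = one;
  complK : forall a, compl (compl a) = a;
  compl_anti : forall a b, meet a b = a -> meet (compl b) (compl a) = compl b;
  meet_compl : forall a, meet a (compl a) = zero;
  join_compl : forall a, join a (compl a) = one
}.

Arguments meet {o}. Arguments join {o}. Arguments compl {o}.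
Arguments zero {o}. Arguments one {o}.

Definition le {L : ortholattice} (a b : L) : Prop := meet a b = a.

Definition orthomodular (L : ortholattice) : Prop :=
  forall a b : L, le a b -> b = join a (meet (compl a) b).

Definition imp {L : ortholattice} (a b : L) : L := join (compl a) (meet a b).

(* eqv k x y a  is  x ≡^(k+3) y  with a_3, a_4, ..., a_(k+3) taken from a
   (only the two displayed variables are substituted at each level). *)
Fixpoint eqv {L : ortholattice} (k : nat) (a : nat -> L) (x y : L) : L :=
  match k with
  | O => join (meet (imp x (a 3)) (imp y (a 3)))
              (meet (imp (compl x) (a 3)) (imp (compl y) (a 3)))
  | S k' => join (eqv k' a x y)
                 (meet (eqv k' a x (a (k' + 4))) (eqv k' a y (a (k' + 4))))
  end.

Definition equivn {L : ortholattice} (n : nat) (a : nat -> L) : L :=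
  eqv (n - 3) a (a 1) (a 2).

Definition nOA (n : nat) (L : ortholattice) : Prop :=
  forall a : nat -> L,
    le (meet (imp (a 1) (a 3)) (equivn n a)) (imp (a 2) (a 3)).

Definition finite_ol (L : ortholattice) : Prop :=
  exists s : list L, forall x : L, In x s.

(* Main.v *)
(* Part (i): the n-th identity is a join one of whose terms is the (n-1)-st one.

   Part (ii): the witnesses are Greechie lattices of height 3, that is 0, 1, atoms and
   coatoms over a graph of orthogonal atoms in which two distinct vertices have at most
   one common neighbour. Fix the value c of a_3 and abbreviate A x = x -> c and
   B x = x' -> c. The nOA law says that every function F obtained from
   E(x,y) = (A x /\ A y) \/ (B x /\ B y) by n - 3 steps
   F_z(x,y) = F(x,y) \/ (F(x,z) /\ F(y,z)) satisfies A x /\ F(x,y) <= A y.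
   If F(x,z) <= A x /\ A z or F(x,z) <= B x /\ B z, then F(x,z) /\ F(z,y) <= E(x,y)
   already holds, so z contributes to F_z(x,y) only through the few remaining pairs; this
   makes the law checkable by computation.

   For n = 4, 5 the lattice comes from a chain of n points x_i with
   E(x_i,x_{i+1}) = t_i' and all t_i orthogonal to one atom w. Composing along the chain
   yields w <= F(x_0,x_{n-1}), while E(x_0,x_{n-1}) is an atom r with r \/ w = 1. All
   n - 2 interior points are needed, so (n+1)OA fails and nOA holds. *)
From Stdlib Require Import List Bool Lia.
Require Import Defs.
Import ListNotations.

(** * Order and the generalized identities *)

Section Order.
Context {L : ortholattice}.
Implicit Types a b c d : L.

Lemma meet_idem a : meet a a = a.
Proof. rewrite <- (join_absorb L a a) at 2. apply meet_absorb. Qed.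

Lemma le_refl a : le a a.
Proof. apply meet_idem. Qed.

Lemma le_trans a b c : le a b -> le b c -> le a c.
Proof. unfold le; intros H K. rewrite <- H, <- meetA, K. reflexivity. Qed.

Lemma meet_le_l a b : le (meet a b) a.
Proof. unfold le. rewrite meetC, meetA, meet_idem. reflexivity. Qed.

Lemma meet_le_r a b : le (meet a b) b.
Proof. rewrite meetC. apply meet_le_l. Qed.

Lemma le_meet a b c : le a b -> le a c -> le a (meet b c).
Proof. unfold le; intros H K. rewrite meetA, H. exact K. Qed.

Lemma le_joinE a b : le a b <-> join a b = b.
Proof.
split; intro H.
- rewrite <- H, joinC, meetC. apply join_absorb.
- unfold le. rewrite <- H. apply meet_absorb.
Qed.

Lemma le_join_l a b : le a (join a b).
Proof. apply meet_absorb. Qed.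

Lemma le_join_r a b : le b (join a b).
Proof. rewrite joinC. apply le_join_l. Qed.

Lemma meet_mono a b c d : le a c -> le b d -> le (meet a b) (meet c d).
Proof.
intros H K; apply le_meet.
- exact (le_trans _ _ _ (meet_le_l a b) H).
- exact (le_trans _ _ _ (meet_le_r a b) K).
Qed.

Lemma join_of_le a b : le b a -> join a b = a.
Proof. intro H. rewrite joinC. apply le_joinE, H. Qed.

End Order.

Lemma nOA_pred n (L : ortholattice) : 3 < n -> nOA n L -> nOA (n - 1) L.
Proof.
intros Hn H a; generalize (H a); unfold equivn.
(* Subtraction on [nat] is truncated; [3 < n] is what makes the level a successor, so that [eqv]
   unfolds to a join. *)
replace (n - 3) with (S (n - 1 - 3)) by lia.
apply le_trans, meet_mono; [apply le_refl | apply le_join_l].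
Qed.

(** * The law in terms of pairs of implications *)

Section Transport.
Context {L : ortholattice}.

(* A variable [x] enters the law only through the pair [(x -> c, x' -> c)], where [c] is the value of [a_3]. *)
Definition point (c x : L) : L * L := (imp x c, imp (compl x) c).

Definition base (p q : L * L) : L :=
  join (meet (fst p) (fst q)) (meet (snd p) (snd q)).

Definition step (z : L * L) (F : L * L -> L * L -> L) (p q : L * L) : L :=
  join (F p q) (meet (F p z) (F q z)).

(** The head of [zs] is the innermost step, so an induction on [zs] starts from [base] and follows
    the order in which a table is updated. The recursion of [eqv] peels off the last variable
    instead; [iter_step_snoc] reconciles the two. *)
Fixpoint iter_step (zs : list (L * L)) (F : L * L -> L * L -> L) :=
  match zs with
  | [] => F
  | z :: zs' => iter_step zs' (step z F)
  end.

Lemma iter_step_snoc zs z F :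
  iter_step (zs ++ [z]) F = step z (iter_step zs F).
Proof. revert F; induction zs as [|y zs IH]; intro F; [reflexivity | apply IH]. Qed.

Lemma eqv_iter_step k (a : nat -> L) (x y : L) :
  eqv k a x y =
  iter_step (map (fun i => point (a 3) (a (i + 4))) (seq 0 k)) base
    (point (a 3) x) (point (a 3) y).
Proof.
revert x y; induction k as [|k IH]; intros x y; [reflexivity |].
rewrite seq_S, map_app; cbn [map plus].
rewrite iter_step_snoc; unfold step.
rewrite <- !IH; reflexivity.
Qed.

Definition symmetric (F : L * L -> L * L -> L) := forall p q, F p q = F q p.

Lemma base_sym : symmetric base.
Proof. intros p q; unfold base. f_equal; apply meetC. Qed.

Lemma step_sym z F : symmetric F -> symmetric (step z F).
Proof. intros H p q; unfold step. rewrite (H p q). f_equal. apply meetC. Qed.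

(** For [v = F p q] the first half is the law. The second is the law with every variable but $a_3$
    complemented, which swaps the components of each point and leaves the value of F the same. Both
    are kept because [half_base] may transport along either component. *)
Definition moves (p q : L * L) (v : L) : Prop :=
  le (meet (fst p) v) (fst q) /\ le (meet (snd p) v) (snd q).

Definition half (p q : L * L) (v : L) : Prop :=
  le v (meet (fst p) (fst q)) \/ le v (meet (snd p) (snd q)).

Lemma half_sym p q v : half p q v -> half q p v.
Proof.
unfold half; rewrite (meetC _ (fst q)), (meetC _ (snd q)); trivial.
Qed.

(** If [v] lies below the first components of [p] and [z], then [w] carries [meet v w] on from [z]
    to [q], so it lies below the first components of [p] and [q]. The second components behave
    alike. *)
Lemma half_base p q v w z :
  half p z v -> moves z q w -> le (meet v w) (base p q).
Proof.
intros [H | H] [K1 K2]; unfold base.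
- eapply le_trans; [| apply le_join_l]; apply le_meet.
  + eapply le_trans; [apply meet_le_l |].
    eapply le_trans; [exact H | apply meet_le_l].
  + eapply le_trans; [| exact K1].
    apply meet_mono; [| apply le_refl].
    eapply le_trans; [exact H | apply meet_le_r].
- eapply le_trans; [| apply le_join_r]; apply le_meet.
  + eapply le_trans; [apply meet_le_l |].
    eapply le_trans; [exact H | apply meet_le_l].
  + eapply le_trans; [| exact K2].
    apply meet_mono; [| apply le_refl].
    eapply le_trans; [exact H | apply meet_le_r].
Qed.

End Transport.

(** * Checking the law on a finite lattice *)

Section Check.
Context {L : ortholattice} (leb : L -> L -> bool).
Hypothesis lebP : forall x y, leb x y = true <-> le x y.

Lemma le_antisym (a b : L) : le a b -> le b a -> a = b.
Proof. unfold le; intros H K. rewrite <- H, meetC. exact K. Qed.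

Definition movesb (p q : L * L) (v : L) : bool :=
  if leb (meet (fst p) v) (fst q) then leb (meet (snd p) v) (snd q) else false.

Definition trivialb (p q : L * L) (v : L) : bool :=
  if (if leb v (meet (fst p) (fst q)) then true
      else leb v (meet (snd p) (snd q)))
  then movesb p q v else false.

(** Only the order is assumed decidable, so equality is tested by antisymmetry. *)
Definition peqb (p q : L * L) : bool :=
  if leb (fst p) (fst q) then
    if leb (fst q) (fst p) then
      if leb (snd p) (snd q) then leb (snd q) (snd p) else false
    else false
  else false.

Definition row : Type := list ((L * L) * L).
Definition table : Type := list ((L * L) * row).

(* A table represents a function [F] on points: a pair that it does not list is one where [F]
   agrees with [base] and which, by [half_base], adds nothing to a step. *)
Definition table0 (pts : list (L * L)) : table :=
  map (fun p =>
    (p, filter (fun e => negb (trivialb p (fst e) (snd e)))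
          (map (fun q => (q, base p q)) pts))) pts.

Definition value (R : table) (p q : L * L) : L :=
  match find (fun r => peqb p (fst r)) R with
  | Some r =>
      match find (fun e => peqb q (fst e)) (snd r) with
      | Some e => snd e
      | None => base p q
      end
  | None => base p q
  end.

(** With [e], [e'] from the row of [z], [g] is the term that a step at [z] adds. It is compared with
    [base] first, which lies below every F in question; the table is searched only if that fails. *)
Definition change (R : table) (e e' : (L * L) * L) : list ((L * L) * (L * L) * L) :=
  let g := meet (snd e) (snd e') in
  if leb g (base (fst e) (fst e')) then [] else
  let f := value R (fst e) (fst e') in
  if leb g f then [] else [(fst e, fst e', join f g)].

Definition changes (R : table) (rz : row) : list ((L * L) * (L * L) * L) :=
  flat_map (fun e => flat_map (change R e) rz) rz.

Definition updates (D : list ((L * L) * (L * L) * L)) (p : L * L) : row :=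
  map (fun d => (snd (fst d), snd d))
    (filter (fun d => peqb p (fst (fst d))) D).

Definition update_row (D : list ((L * L) * (L * L) * L)) (p : L * L) (r : row) : row :=
  let u := updates D p in
  u ++ filter (fun e => negb (existsb (fun e' => peqb (fst e) (fst e')) u)) r.

Definition update (D : list ((L * L) * (L * L) * L)) (R : table) : table :=
  map (fun r => (fst r, update_row D (fst r) (snd r))) R.

Definition movesb_all (R : table) : bool :=
  forallb (fun r => forallb (fun e => movesb (fst r) (fst e) (snd e)) (snd r)) R.

(** A search over sequences of at most [k] points [z], pruned at each [z] that changes nothing.
    Testing the table at every level covers the shorter sequences. *)
Fixpoint check (k : nat) (R : table) : bool :=
  if movesb_all R then
    match k with
    | O => true
    | S k' =>
        forallb (fun r =>
          match changes R (snd r) with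
          | [] => true
          | D => check k' (update D R)
          end) R
    end
  else false.

Lemma peqbP p q : peqb p q = true <-> p = q.
Proof.
unfold peqb; split.
- destruct p as [a b], q as [c d]; cbn.
  destruct (leb a c) eqn:H1, (leb c a) eqn:H2, (leb b d) eqn:H3;
    try discriminate; intro H4.
  apply lebP in H1, H2, H3, H4.
  f_equal; apply le_antisym; assumption.
- intros <-. rewrite !(proj2 (lebP _ _) (le_refl _)). reflexivity.
Qed.

Lemma movesbP p q v : movesb p q v = true -> moves p q v.
Proof.
unfold movesb, moves.
destruct (leb _ (fst q)) eqn:H; [| discriminate].
rewrite <- !lebP; auto.
Qed.

Lemma trivialbP p q v : trivialb p q v = true -> half p q v /\ moves p q v.
Proof.
unfold trivialb, half; intro H.
destruct (leb v (meet (fst p) (fst q))) eqn:H1.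
- apply lebP in H1. split; [auto | apply movesbP, H].
- destruct (leb v (meet (snd p) (snd q))) eqn:H2; [| discriminate].
  apply lebP in H2. split; [auto | apply movesbP, H].
Qed.

(** * Tables as representations of functions on points *)

Section Table.
Variable pts : list (L * L).

(** Distinct x may give the same point, so rows and entries may repeat; every copy is constrained,
    and a look-up may return any of them. [rep_other] records [moves] as well, because [movesb_all]
    sees only listed pairs. *)
Record represents (R : table) (F : L * L -> L * L -> L) : Prop := {
  rep_entry : forall p r q v, In (p, r) R -> In (q, v) r ->
    In q pts /\ v = F p q;
  rep_key : forall p r, In (p, r) R -> In p pts;
  rep_row : forall p, In p pts -> exists r, In (p, r) R;
  rep_other : forall p r q, In (p, r) R -> In q pts -> (forall v, ~ In (q, v) r) ->
    F p q = base p q /\ half p q (base p q) /\ moves p q (base p q)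
}.

Lemma find_entry (q : L * L) (r : row) :
  (exists v, In (q, v) r /\ find (fun e => peqb q (fst e)) r = Some (q, v)) \/
  ((forall v, ~ In (q, v) r) /\ find (fun e => peqb q (fst e)) r = None).
Proof.
destruct (find _ r) as [[q' v] |] eqn:H.
- left. destruct (find_some _ _ H) as [H1 H2].
  apply peqbP in H2; cbn in H2; subst q'. exists v; auto.
- right. split; [| reflexivity]. intros v Hv.
  pose proof (find_none _ _ H _ Hv) as H1; cbn in H1.
  rewrite (proj2 (peqbP q q) eq_refl) in H1. discriminate.
Qed.

Lemma rep_table0 : represents (table0 pts) base.
Proof.
unfold table0; split.
- intros p r q v Hp Hq. apply in_map_iff in Hp as [p' [[= <- <-] Hp]].
  apply filter_In in Hq as [Hq _].
  apply in_map_iff in Hq as [q' [[= <- <-] Hq]]. auto.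
- intros p r Hp. apply in_map_iff in Hp as [p' [[= <- _] Hp]]. exact Hp.
- intros p Hp. eexists. apply in_map_iff. exists p. split; [reflexivity | exact Hp].
- intros p r q Hp Hq Hv. apply in_map_iff in Hp as [p' [[= <- <-] Hp]].
  split; [reflexivity |]. apply trivialbP.
  destruct (trivialb p' q (base p' q)) eqn:H; [reflexivity |].
  exfalso; apply (Hv (base p' q)), filter_In; cbn.
  rewrite H; split; [| reflexivity].
  apply in_map_iff; exists q; auto.
Qed.

Lemma value_rep R F p q : represents R F -> In p pts -> In q pts -> value R p q = F p q.
Proof.
intros HR Hp Hq. unfold value.
destruct (find _ R) as [[p' r] |] eqn:H.
- destruct (find_some _ _ H) as [H1 H2].
  apply peqbP in H2; cbn in H2; subst p'. cbn [snd].
  destruct (find_entry q r) as [[v [Hv ->]] | [Hv ->]].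
  + apply (rep_entry _ _ HR _ _ _ _ H1 Hv).
  + symmetry; apply (rep_other _ _ HR _ _ _ H1 Hq Hv).
- destruct (rep_row _ _ HR _ Hp) as [r Hr].
  pose proof (find_none _ _ H _ Hr) as H1; cbn in H1.
  rewrite (proj2 (peqbP p p) eq_refl) in H1. discriminate.
Qed.

Lemma rep_moves R F : represents R F -> movesb_all R = true ->
  forall p q, In p pts -> In q pts -> moves p q (F p q).
Proof.
intros HR H p q Hp Hq. destruct (rep_row _ _ HR _ Hp) as [r Hr].
destruct (find_entry q r) as [[v [Hv _]] | [Hv _]].
- destruct (rep_entry _ _ HR _ _ _ _ Hr Hv) as [_ <-].
  unfold movesb_all in H; rewrite forallb_forall in H.
  specialize (H _ Hr); cbn in H; rewrite forallb_forall in H.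
  apply movesbP, (H _ Hv).
- destruct (rep_other _ _ HR _ _ _ Hr Hq Hv) as [-> [_ H1]]. exact H1.
Qed.

Section Step.
Variables (R : table) (F : L * L -> L * L -> L) (z : L * L) (rz : row).
Hypothesis HR : represents R F.
Hypothesis F_sym : symmetric F.
Hypothesis F_base : forall p q, le (base p q) (F p q).
Hypothesis F_moves : forall p q, In p pts -> In q pts -> moves p q (F p q).
Hypothesis Hz : In z pts.
Hypothesis Hrz : In (z, rz) R.

Lemma change_sound p q v :
  In (p, q, v) (changes R rz) -> In p pts /\ In q pts /\ v = step z F p q.
Proof.
intro H. apply in_flat_map in H as [[p' a] [Ha H]].
apply in_flat_map in H as [[q' b] [Hb H]].
unfold change in H; cbn in H.
destruct (leb _ _); [contradiction |].
destruct (leb _ _); [contradiction |].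
destruct H as [[= <- <- <-] | []].
destruct (rep_entry _ _ HR _ _ _ _ Hrz Ha) as [Hp ->].
destruct (rep_entry _ _ HR _ _ _ _ Hrz Hb) as [Hq ->].
repeat split; auto. unfold step.
rewrite (value_rep R F p' q' HR Hp Hq), (F_sym p' z), (F_sym q' z). reflexivity.
Qed.

(** If [p] and [q] are both listed in the row of [z], the pair was examined by [change]. Otherwise
    one of the two values is a trivial one, and [half_base] with [F_moves] for the other puts the
    new term below [base]. *)
Lemma change_complete p q : In p pts -> In q pts ->
  (forall v, ~ In (p, q, v) (changes R rz)) -> step z F p q = F p q.
Proof.
intros Hp Hq H. unfold step. apply join_of_le.
(* Both factors are now values in the row of [z]. *)
rewrite (F_sym p z), (F_sym q z).
destruct (find_entry p rz) as [[a [Ha _]] | [Ha _]];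
  [destruct (find_entry q rz) as [[b [Hb _]] | [Hb _]] |].
- destruct (rep_entry _ _ HR _ _ _ _ Hrz Ha) as [_ <-].
  destruct (rep_entry _ _ HR _ _ _ _ Hrz Hb) as [_ <-].
  assert (Hc : forall v, ~ In (p, q, v) (change R (p, a) (q, b))).
  { intros v Hv; apply (H v). apply in_flat_map; exists (p, a); split; [exact Ha |].
    apply in_flat_map; exists (q, b); auto. }
  unfold change in Hc; cbn in Hc.
  destruct (leb _ (base p q)) eqn:H1.
  + apply lebP in H1. eapply le_trans; [exact H1 | apply F_base].
  + rewrite (value_rep R F p q HR Hp Hq) in Hc.
    destruct (leb _ (F p q)) eqn:H2; [apply lebP, H2 |].
    destruct (Hc _ (or_introl eq_refl)).
- destruct (rep_other _ _ HR _ _ _ Hrz Hq Hb) as [E [Hh _]].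
  rewrite E. eapply le_trans; [| apply F_base].
  rewrite meetC, (base_sym p q). apply (half_base q p _ _ z).
  + apply half_sym, Hh.
  + apply F_moves; auto.
- destruct (rep_other _ _ HR _ _ _ Hrz Hp Ha) as [E [Hh _]].
  rewrite E. eapply le_trans; [| apply F_base].
  apply (half_base p q _ _ z).
  + apply half_sym, Hh.
  + apply F_moves; auto.
Qed.

Lemma in_updates D p q v : In (q, v) (updates D p) <-> In (p, q, v) D.
Proof.
unfold updates; rewrite in_map_iff; split.
- intros [[[p' q'] v'] [[= <- <-] H]]. apply filter_In in H as [H H1].
  apply peqbP in H1; cbn in H1; subst p'. exact H.
- intro H. exists (p, q, v); split; [reflexivity |].
  apply filter_In; split; [exact H | apply peqbP; reflexivity].
Qed.

(** Entries from [changes] are right by [change_sound]. Surviving old entries and unlisted pairs lie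
    outside [changes], so F is unchanged there by [change_complete]. *)
Lemma rep_update : represents (update (changes R rz) R) (step z F).
Proof.
set (D := changes R rz).
assert (Hex : forall p q, existsb (fun e' => peqb q (fst e')) (updates D p) = false ->
  forall v, ~ In (p, q, v) D).
{ intros p q H v Hv. apply in_updates in Hv.
  assert (existsb (fun e' => peqb q (fst e')) (updates D p) = true) as K.
  { apply existsb_exists; exists (q, v); split; [exact Hv | apply peqbP; reflexivity]. }
  rewrite H in K; discriminate. }
assert (Hkey : forall p r, In (p, r) (update D R) ->
  exists r0, In (p, r0) R /\ r = update_row D p r0).
{ intros p r H. apply in_map_iff in H as [[p' r0] [[= <- <-] H]]. exists r0; auto. }
split.
- intros p r q v Hp Hq. destruct (Hkey _ _ Hp) as [r0 [Hr0 ->]].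
  unfold update_row in Hq; apply in_app_iff in Hq as [Hq | Hq].
  + apply in_updates in Hq. apply change_sound, Hq.
  + apply filter_In in Hq as [Hq Hn].
    destruct (rep_entry _ _ HR _ _ _ _ Hr0 Hq) as [H1 ->].
    split; [exact H1 |]. symmetry; apply change_complete;
      [exact (rep_key _ _ HR _ _ Hr0) | exact H1 |].
    apply Hex. cbn in Hn. destruct (existsb _ _); [discriminate | reflexivity].
- intros p r Hp. destruct (Hkey _ _ Hp) as [r0 [Hr0 _]]. exact (rep_key _ _ HR _ _ Hr0).
- intros p Hp. destruct (rep_row _ _ HR _ Hp) as [r Hr].
  exists (update_row D p r). apply in_map_iff. exists (p, r); auto.
- intros p r q Hp Hq Hv. destruct (Hkey _ _ Hp) as [r0 [Hr0 ->]].
  assert (HD : forall v, ~ In (p, q, v) D).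
  { intros v H. apply (Hv v). unfold update_row. apply in_app_iff; left.
    apply in_updates, H. }
  assert (Hr : forall v, ~ In (q, v) r0).
  { intros v H. apply (Hv v). unfold update_row. apply in_app_iff; right.
    apply filter_In; split; [exact H |].
    destruct (existsb _ _) eqn:K; [| reflexivity].
    apply existsb_exists in K as [[q' v'] [K1 K2]].
    apply peqbP in K2; cbn in K2; subst q'.
    apply in_updates in K1. destruct (HD _ K1). }
  destruct (rep_other _ _ HR _ _ _ Hr0 Hq Hr) as [E [H1 H2]].
  split; [| auto]. rewrite <- E. apply change_complete;
    [exact (rep_key _ _ HR _ _ Hr0) | exact Hq | exact HD].
Qed.

End Step.

(** A step without changes agrees with F on [pts] only, so the two functions need not be equal. *)
Lemma rep_ext R F G : represents R F ->
  (forall p q, In p pts -> In q pts -> G p q = F p q) -> represents R G.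
Proof.
intros HR E. split.
- intros p r q v Hp Hq. destruct (rep_entry _ _ HR _ _ _ _ Hp Hq) as [H1 H2].
  rewrite E; [auto | exact (rep_key _ _ HR _ _ Hp) | exact H1].
- apply (rep_key _ _ HR).
- apply (rep_row _ _ HR).
- intros p r q Hp Hq Hv. rewrite E; [| exact (rep_key _ _ HR _ _ Hp) | exact Hq].
  exact (rep_other _ _ HR _ _ _ Hp Hq Hv).
Qed.

Lemma check_sound k R F zs : represents R F -> symmetric F ->
  (forall p q, le (base p q) (F p q)) -> check k R = true ->
  length zs <= k -> (forall z, In z zs -> In z pts) ->
  forall p q, In p pts -> In q pts -> moves p q (iter_step zs F p q).
Proof.
revert k R F; induction zs as [|z zs IH]; intros k R F HR Fs Fb Hk Hlen Hzs.
- destruct k; cbn in Hk; destruct (movesb_all R) eqn:Hm; try discriminate;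
    apply (rep_moves _ _ HR Hm).
- cbn in Hlen. destruct k as [|k]; [lia |].
  cbn [iter_step].
  assert (Hm : movesb_all R = true)
    by (cbn in Hk; destruct (movesb_all R); [reflexivity | discriminate]).
  pose proof (rep_moves _ _ HR Hm) as Fm.
  assert (Hz : In z pts) by (apply Hzs; left; reflexivity).
  destruct (rep_row _ _ HR _ Hz) as [rz Hrz].
  assert (step_base : forall p q, le (base p q) (step z F p q))
    by (intros p q; exact (le_trans _ _ _ (Fb p q) (le_join_l _ _))).
  pose proof (rep_update R F z rz HR Fs Fb Fm Hz Hrz) as HU.
  destruct (changes R rz) as [|d D] eqn:HD.
  (* A [z] that changes nothing is dropped without spending depth: the same table represents the new
     function. *)
  + apply (IH (S k) R); auto using step_sym; [| lia | intros; apply Hzs; right; auto].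
    apply (rep_ext R F); [exact HR |]. intros p q Hp Hq.
    apply (change_complete R F z rz HR Fs Fb Fm Hz Hrz p q Hp Hq).
    rewrite HD; auto.
  + apply (IH k (update (d :: D) R)); auto using step_sym;
      [| lia | intros; apply Hzs; right; auto].
    cbn in Hk; rewrite Hm in Hk; rewrite forallb_forall in Hk.
    specialize (Hk _ Hrz); cbn [snd] in Hk; rewrite HD in Hk; exact Hk.
Qed.

End Table.

Lemma nOA_check n (els : list L) : (forall x, In x els) -> 3 <= n ->
  forallb (fun c => check (n - 3) (table0 (map (point c) els))) els = true ->
  nOA n L.
Proof.
intros Hels Hn H a. unfold equivn. rewrite eqv_iter_step.
rewrite forallb_forall in H.
assert (Hp : forall x, In (point (a 3) x) (map (point (a 3)) els))
  by (intro x; apply in_map, Hels).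
(* The law is the first half of [moves]; the [n - 3] steps are at the points of $a_4,\dots,a_n$. *)
refine (proj1 (check_sound _ (n - 3) _ base _ (rep_table0 _) base_sym
  (fun p q => le_refl _) (H (a 3) (Hels _)) _ _ _ _ (Hp (a 1)) (Hp (a 2)))).
- rewrite length_map, length_seq; lia.
- intros z Hz. apply in_map_iff in Hz as [i [<- _]]. apply Hp.
Qed.

End Check.

(** * Lattices of height 3 *)

(* [Via w]: the vertices are distinct and [w] is their only common neighbour. *)
Inductive link (V : Type) : Type := Same | Via (w : V) | Apart.
Arguments Same {V}. Arguments Via {V}. Arguments Apart {V}.

(** [conn] is stored as data so that meets and joins are read off directly. [adj_conn] puts every
    edge in a triangle, that is a block; orthomodularity rests on it. *)
Record graph := Graph {
  vertex : Type;
  adj : vertex -> vertex -> bool;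
  conn : vertex -> vertex -> link vertex;
  adj_sym : forall a b, adj a b = true -> adj b a = true;
  adj_irrefl : forall a, adj a a = false;
  conn_spec : forall a b,
    match conn a b with
    | Same => a = b
    | Via w => a <> b /\ forall c, adj a c && adj b c = true <-> c = w
    | Apart => a <> b /\ forall c, adj a c && adj b c = false
    end;
  adj_conn : forall a b, adj a b = true -> conn a b <> Apart
}.

Section Graph.
Variable G : graph.

Inductive elt : Type := Bot | Top | At (a : vertex G) | Co (a : vertex G).

Definition eltle (x y : elt) : bool :=
  match x, y with
  | Bot, _ | _, Top => true
  | At a, At b | Co a, Co b => match conn G a b with Same => true | _ => false end
  | At a, Co b => adj G a b
  | _, _ => false
  end.

Definition elt_compl (x : elt) : elt :=
  match x with Bot => Top | Top => Bot | At a => Co a | Co a => At a end.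

Definition elt_meet (x y : elt) : elt :=
  match x, y with
  | Bot, _ | _, Bot => Bot
  | Top, z | z, Top => z
  | At a, At b => match conn G a b with Same => At a | _ => Bot end
  | At a, Co b | Co b, At a => if adj G a b then At a else Bot
  | Co a, Co b =>
      match conn G a b with Same => Co a | Via w => At w | Apart => Bot end
  end.

Definition elt_join (x y : elt) : elt :=
  match x, y with
  | Top, _ | _, Top => Top
  | Bot, z | z, Bot => z
  | Co a, Co b => match conn G a b with Same => Co a | _ => Top end
  | At a, Co b | Co b, At a => if adj G a b then Co b else Top
  | At a, At b =>
      match conn G a b with Same => At a | Via w => Co w | Apart => Top end
  end.

Lemma conn_refl a : conn G a a = Same.
Proof.
pose proof (conn_spec G a a) as H. destruct (conn G a a); [reflexivity | | ];
  destruct H as [H _]; destruct (H eq_refl).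
Qed.

Lemma adjC a b : adj G a b = adj G b a.
Proof.
destruct (adj G a b) eqn:H, (adj G b a) eqn:K; try reflexivity;
  [rewrite (adj_sym _ _ _ H) in K | rewrite (adj_sym _ _ _ K) in H]; discriminate.
Qed.

(** [conn_spec] determines the value of [conn], since the common neighbour is unique. *)
Lemma connC a b : conn G a b = conn G b a.
Proof.
pose proof (conn_spec G a b) as H. pose proof (conn_spec G b a) as K.
destruct (conn G a b) as [|w|].
- subst b. rewrite conn_refl; reflexivity.
- destruct H as [H H1], (conn G b a) as [|w'|].
  + congruence.
  + destruct K as [_ K]. f_equal. apply K. rewrite andb_comm. apply H1. reflexivity.
  + destruct K as [_ K]. specialize (K w). rewrite andb_comm in K.
    rewrite (proj2 (H1 w) eq_refl) in K; discriminate.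
- destruct H as [H H1], (conn G b a) as [|w'|].
  + congruence.
  + destruct K as [_ K]. specialize (H1 w'). rewrite andb_comm in H1.
    rewrite (proj2 (K w') eq_refl) in H1; discriminate.
  + reflexivity.
Qed.

Lemma eltle_refl x : eltle x x = true.
Proof. destruct x; cbn; rewrite ?conn_refl; reflexivity. Qed.

Lemma conn_same a b : conn G a b = Same -> a = b.
Proof. intro H. pose proof (conn_spec G a b) as K. rewrite H in K. exact K. Qed.

Lemma conn_via a b w : conn G a b = Via w -> adj G a w = true /\ adj G b w = true.
Proof.
intro H. pose proof (conn_spec G a b) as K. rewrite H in K.
apply andb_true_iff, K. reflexivity.
Qed.

Lemma conn_unique a b w c : conn G a b = Via w ->
  adj G a c = true -> adj G b c = true -> c = w.
Proof.
intros H H1 H2. pose proof (conn_spec G a b) as K. rewrite H in K.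
apply K. rewrite H1, H2. reflexivity.
Qed.

Lemma conn_apart a b c : conn G a b = Apart ->
  adj G a c = true -> adj G b c = true -> False.
Proof.
intros H H1 H2. pose proof (conn_spec G a b) as K. rewrite H in K.
destruct K as [_ K]. specialize (K c). rewrite H1, H2 in K. discriminate.
Qed.

Lemma eltle_antisym x y : eltle x y = true -> eltle y x = true -> x = y.
Proof.
destruct x as [| |a|a], y as [| |b|b]; cbn; try discriminate; try reflexivity;
  destruct (conn G a b) eqn:H; try discriminate;
  rewrite (conn_same _ _ H); reflexivity.
Qed.

Lemma eltle_trans x y z : eltle x y = true -> eltle y z = true -> eltle x z = true.
Proof.
destruct x as [| |a|a], y as [| |b|b], z as [| |c|c]; cbn; try discriminate; auto;
  repeat match goal with
  | |- context [match conn G ?u ?v with _ => _ end = true -> _] =>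
      destruct (conn G u v) eqn:?; try discriminate
  end;
  repeat match goal with H : conn G _ _ = Same |- _ => apply conn_same in H; subst end;
  rewrite ?conn_refl; auto.
Qed.

Lemma eltle_compl x y : eltle (elt_compl y) (elt_compl x) = eltle x y.
Proof.
destruct x as [| |a|a], y as [| |b|b]; cbn; try reflexivity;
  [rewrite connC | rewrite adjC | rewrite connC]; reflexivity.
Qed.

Lemma elt_complK x : elt_compl (elt_compl x) = x.
Proof. destruct x; reflexivity. Qed.

(** Reduces the laws of join to those of meet. *)
Lemma elt_de_morgan x y :
  elt_join x y = elt_compl (elt_meet (elt_compl x) (elt_compl y)).
Proof.
destruct x as [| |a|a], y as [| |b|b]; cbn; try reflexivity;
  try (destruct (conn G a b); reflexivity);
  rewrite (adjC a b); destruct (adj G b a); reflexivity.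
Qed.

Lemma elt_meetC x y : elt_meet x y = elt_meet y x.
Proof.
destruct x as [| |a|a], y as [| |b|b]; cbn; try reflexivity;
  rewrite connC; destruct (conn G b a) eqn:H; try reflexivity;
  rewrite (conn_same _ _ H); reflexivity.
Qed.

Lemma elt_meet_l x y : eltle (elt_meet x y) x = true.
Proof.
destruct x as [| |a|a], y as [| |b|b]; cbn; rewrite ?conn_refl; try reflexivity.
- destruct (conn G a b); cbn; rewrite ?conn_refl; reflexivity.
- destruct (adj G a b); cbn; rewrite ?conn_refl; reflexivity.
- destruct (adj G b a) eqn:H; cbn; rewrite ?H; reflexivity.
- destruct (conn G a b) eqn:H; cbn; rewrite ?conn_refl; try reflexivity.
  apply adj_sym, (conn_via _ _ _ H).
Qed.

(** The essential case is an atom below two distinct coatoms: it is a common neighbour of their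
    vertices, hence the unique one. Associativity and absorption then follow from the order. *)
Lemma elt_meet_glb x y z :
  eltle z x = true -> eltle z y = true -> eltle z (elt_meet x y) = true.
Proof.
destruct z as [| |c|c]; [reflexivity | | |].
- destruct x as [| |a|a], y as [| |b|b]; cbn; try discriminate; auto.
- destruct x as [| |a|a], y as [| |b|b]; cbn; try discriminate; auto.
  + destruct (conn G c a) eqn:H1, (conn G c b) eqn:H2; try discriminate.
    apply conn_same in H1, H2; subst. rewrite conn_refl; cbn. rewrite conn_refl; auto.
  + destruct (conn G c a) eqn:H1; try discriminate.
    apply conn_same in H1; subst. intros _ ->; cbn. rewrite conn_refl; auto.
  + destruct (conn G c b) eqn:H1; try discriminate.
    apply conn_same in H1; subst. intros ->; cbn. rewrite conn_refl; auto.
  + intros H1%adj_sym H2%adj_sym. destruct (conn G a b) as [|w|] eqn:H; cbn.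
    * apply adj_sym, H1.
    * rewrite (conn_unique _ _ _ _ H H1 H2), conn_refl; reflexivity.
    * destruct (conn_apart _ _ _ H H1 H2).
- destruct x as [| |a|a], y as [| |b|b]; cbn; try discriminate; auto.
  destruct (conn G c a) eqn:H1, (conn G c b) eqn:H2; try discriminate.
  apply conn_same in H1, H2; subst. rewrite conn_refl; cbn. rewrite conn_refl; auto.
Qed.

Lemma elt_meet_r x y : eltle (elt_meet x y) y = true.
Proof. rewrite elt_meetC. apply elt_meet_l. Qed.

Lemma elt_meet_eq x y : eltle x y = true <-> elt_meet x y = x.
Proof.
split; intro H.
- apply eltle_antisym; [apply elt_meet_l |].
  apply elt_meet_glb; [apply eltle_refl | exact H].
- rewrite <- H. apply elt_meet_r.
Qed.

Lemma elt_meetA x y z : elt_meet x (elt_meet y z) = elt_meet (elt_meet x y) z.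
Proof.
apply eltle_antisym; repeat apply elt_meet_glb;
  eauto using elt_meet_l, elt_meet_r, eltle_trans.
Qed.

Lemma elt_joinC x y : elt_join x y = elt_join y x.
Proof. rewrite !elt_de_morgan, elt_meetC. reflexivity. Qed.

Lemma elt_joinA x y z : elt_join x (elt_join y z) = elt_join (elt_join x y) z.
Proof. rewrite !elt_de_morgan, !elt_complK, elt_meetA. reflexivity. Qed.

Lemma elt_join_l x y : eltle x (elt_join x y) = true.
Proof.
rewrite elt_de_morgan, <- eltle_compl, elt_complK. apply elt_meet_l.
Qed.

Lemma elt_meet_absorb x y : elt_meet x (elt_join x y) = x.
Proof. apply elt_meet_eq, elt_join_l. Qed.

Lemma elt_compl_anti x y :
  elt_meet x y = x -> elt_meet (elt_compl y) (elt_compl x) = elt_compl y.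
Proof. rewrite <- !elt_meet_eq, eltle_compl. trivial. Qed.

Lemma elt_join_absorb x y : elt_join x (elt_meet x y) = x.
Proof.
rewrite elt_de_morgan.
rewrite (proj1 (elt_meet_eq (elt_compl x) (elt_compl (elt_meet x y)))).
- apply elt_complK.
- rewrite eltle_compl. apply elt_meet_l.
Qed.

Lemma elt_meet_compl x : elt_meet x (elt_compl x) = Bot.
Proof. destruct x; cbn; rewrite ?adj_irrefl; reflexivity. Qed.

Lemma elt_join_compl x : elt_join x (elt_compl x) = Top.
Proof. destruct x; cbn; rewrite ?adj_irrefl; reflexivity. Qed.

Definition greechie : ortholattice := {|
  car := elt; meet := elt_meet; join := elt_join; compl := elt_compl;
  zero := Bot; one := Top;
  meetC := elt_meetC; joinC := elt_joinC; meetA := elt_meetA; joinA := elt_joinA;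
  meet_absorb := elt_meet_absorb; join_absorb := elt_join_absorb;
  meet0 := fun x => eq_refl; join1 := fun x => eq_refl;
  complK := elt_complK; compl_anti := elt_compl_anti;
  meet_compl := elt_meet_compl; join_compl := elt_join_compl
|}.

(** The essential case is $a\le b'$ for adjacent [a], [b]. Their common neighbour [w] is $a'\cap
    b'$; as [b] is the common neighbour of [a] and [w], $a\cup w=b'$. *)
Lemma greechie_orthomodular : orthomodular greechie.
Proof.
intros x y H. apply elt_meet_eq in H. cbn.
destruct x as [| |a|a], y as [| |b|b]; cbn in *; try discriminate;
  rewrite ?adj_irrefl, ?conn_refl; try reflexivity.
- destruct (conn G a b) eqn:H1; try discriminate.
  apply conn_same in H1; subst b. rewrite adj_irrefl; reflexivity.
- destruct (conn G a b) as [|w|] eqn:H1; cbn.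
  + apply conn_same in H1; subst b. rewrite adj_irrefl in H; discriminate.
  + destruct (conn_via _ _ _ H1) as [H2 H3].
    destruct (conn G a w) as [|u|] eqn:H4.
    * apply conn_same in H4; subst w. rewrite adj_irrefl in H2; discriminate.
    * f_equal. apply (conn_unique _ _ _ _ H4 H), adj_sym, H3.
    * destruct (conn_apart _ _ _ H4 H (adj_sym _ _ _ H3)).
  + destruct (adj_conn _ _ _ H H1).
- destruct (conn G a b) eqn:H1; try discriminate.
  apply conn_same in H1; subst b. rewrite adj_irrefl; reflexivity.
Qed.

Definition elts (vs : list (vertex G)) : list elt :=
  Bot :: Top :: map At vs ++ map Co vs.

Lemma in_elts vs : (forall a, In a vs) -> forall x, In x (elts vs).
Proof.
intros H x. unfold elts; cbn; rewrite in_app_iff, !in_map_iff.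
destruct x as [| |a|a]; eauto 6.
Qed.

End Graph.

(** * Graphs on 28 vertices given by blocks *)

Inductive atom : Type :=
| a0 | a1 | a2 | a3 | a4 | a5 | a6 | a7 | a8 | a9 | a10 | a11 | a12 | a13 | a14 | a15 | a16 | a17 | a18 | a19 | a20 | a21 | a22 | a23 | a24 | a25 | a26 | a27.

(* A function of the index as an explicit case table, so that evaluating [tab f] stores all its values. *)
Definition tab {T : Type} (f : nat -> T) (a : atom) : T :=
  match a with
  | a0 => f 0 | a1 => f 1 | a2 => f 2 | a3 => f 3 | a4 => f 4 | a5 => f 5 | a6 => f 6
  | a7 => f 7 | a8 => f 8 | a9 => f 9 | a10 => f 10 | a11 => f 11 | a12 => f 12 | a13 => f 13
  | a14 => f 14 | a15 => f 15 | a16 => f 16 | a17 => f 17 | a18 => f 18 | a19 => f 19 | a20 => f 20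
  | a21 => f 21 | a22 => f 22 | a23 => f 23 | a24 => f 24 | a25 => f 25 | a26 => f 26 | a27 => f 27
  end.

(** [chain 4] needs all 28 vertices. In the smaller examples the remaining ones are isolated, and
    each adds only a four-element summand glued at 0 and 1. *)
Definition atoms : list atom :=
  [a0; a1; a2; a3; a4; a5; a6; a7; a8; a9; a10; a11; a12; a13; a14; a15; a16; a17; a18; a19; a20; a21; a22; a23; a24; a25; a26; a27].

Definition index : atom -> nat := tab (fun i => i).

Lemma in_atoms a : In a atoms.
Proof. destruct a; cbn; tauto. Qed.

Lemma index_inj a b : index a = index b -> a = b.
Proof.
assert (H : forall c, nth (index c) atoms a0 = c) by (intros []; reflexivity).
intro E. rewrite <- (H a), <- (H b), E. reflexivity.
Qed.

Definition atom_eqb (a b : atom) : bool := Nat.eqb (index a) (index b).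

Lemma atom_eqbP a b : atom_eqb a b = true <-> a = b.
Proof.
unfold atom_eqb. rewrite PeanoNat.Nat.eqb_eq. split; [apply index_inj | congruence].
Qed.

Definition blocks : Type := list (nat * nat * nat).

Definition in_block (i : nat) (b : nat * nat * nat) : bool :=
  let '(x, y, z) := b in Nat.eqb i x || Nat.eqb i y || Nat.eqb i z.

Definition block_adj (bl : blocks) (i j : nat) : bool :=
  negb (Nat.eqb i j) && existsb (fun b => in_block i b && in_block j b) bl.

(** [find] returns the first common neighbour; that there is no other is tested by [graph_ok]. *)
Definition block_conn (bl : blocks) (i j : nat) : link atom :=
  if Nat.eqb i j then Same else
  match find (fun c => block_adj bl i (index c) && block_adj bl j (index c)) atoms with
  | Some c => Via c
  | None => Apart
  end.

Definition graph_ok (ad : atom -> atom -> bool) (co : atom -> atom -> link atom) : bool :=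
  forallb (fun a => negb (ad a a) && forallb (fun b =>
    implb (ad a b) (ad b a) &&
    match co a b with
    | Same => atom_eqb a b
    | Via w => negb (atom_eqb a b) &&
        forallb (fun c => Bool.eqb (ad a c && ad b c) (atom_eqb c w)) atoms
    | Apart => negb (atom_eqb a b) && negb (ad a b) &&
        forallb (fun c => negb (ad a c && ad b c)) atoms
    end) atoms) atoms.

Section Ok.
Variables (ad : atom -> atom -> bool) (co : atom -> atom -> link atom).
Hypothesis ok : graph_ok ad co = true.

Lemma graph_ok_at a b : ad a a = false /\ (ad a b = true -> ad b a = true) /\
  match co a b with
  | Same => a = b
  | Via w => a <> b /\ forall c, ad a c && ad b c = true <-> c = w
  | Apart => a <> b /\ forall c, ad a c && ad b c = false
  end /\ (ad a b = true -> co a b <> Apart).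
Proof.
unfold graph_ok in ok; rewrite forallb_forall in ok.
specialize (ok a (in_atoms a)). apply andb_true_iff in ok as [H1 H2].
rewrite forallb_forall in H2. specialize (H2 b (in_atoms b)).
apply andb_true_iff in H2 as [H2 H3].
split; [destruct (ad a a); [discriminate | reflexivity] |].
split; [intro K; rewrite K in H2; exact H2 |].
assert (Hne : negb (atom_eqb a b) = true -> a <> b).
{ intros K E. apply atom_eqbP in E. rewrite E in K; discriminate. }
destruct (co a b) as [|w|].
- split; [apply atom_eqbP, H3 | discriminate].
- apply andb_true_iff in H3 as [H3 H4]. rewrite forallb_forall in H4.
  split; [split; [auto |] | discriminate].
  intro c. specialize (H4 c (in_atoms c)). apply eqb_prop in H4. rewrite H4.
  apply atom_eqbP.
- apply andb_true_iff in H3 as [H3 H4]. apply andb_true_iff in H3 as [H3 H5].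
  rewrite forallb_forall in H4. split; [split; [auto |] |].
  + intro c. specialize (H4 c (in_atoms c)).
    destruct (_ && _); [discriminate | reflexivity].
  + intro K; rewrite K in H5; discriminate.
Qed.

Definition atom_graph : graph := {|
  vertex := atom; adj := ad; conn := co;
  adj_sym := fun a b => proj1 (proj2 (graph_ok_at a b));
  adj_irrefl := fun a => proj1 (graph_ok_at a a);
  conn_spec := fun a b => proj1 (proj2 (proj2 (graph_ok_at a b)));
  adj_conn := fun a b => proj2 (proj2 (proj2 (graph_ok_at a b)))
|}.
End Ok.

(** * The three examples *)

(* Found by computer search; the analogous [chain 2] violates the 3OA law. *)
Definition blocks3 : blocks :=
  [(10, 13, 16); (3, 11, 13); (4, 12, 13); (0, 4, 8); (0, 5, 7); (1, 2, 6);
   (1, 4, 15); (2, 5, 10); (3, 6, 14); (3, 7, 9)].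

(* Atom 0 is [c'] and atom 1 is [w]; the point [x_i] is the atom [p] of the block
   [(p, s, r)], where [r] is orthogonal to [c'], and the block [(s, p_{i+1}, t)] links it to
   [x_{i+1}]. The last block reuses the atom [r = 5] of the first one. *)
Definition chain (k : nat) : blocks :=
  flat_map (fun i =>
    let p := 2 + 6 * i in let s := 3 + 6 * i in
    let t := 4 + 6 * i in let r := 5 + 6 * i in
    [(p, s, r); (s, 6 + p, t); (0, r, 6 + 6 * i); (1, t, 7 + 6 * i)]) (seq 0 k) ++
  [(2 + 6 * k, 3 + 6 * k, 5)].

Definition adj3 : atom -> atom -> bool :=
  Eval vm_compute in tab (fun i => tab (block_adj blocks3 i)).

Definition conn3 : atom -> atom -> link atom :=
  Eval vm_compute in tab (fun i => tab (block_conn blocks3 i)).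

Lemma graph_ok3 : graph_ok adj3 conn3 = true.
Proof. vm_compute; reflexivity. Qed.

Definition graph3 : graph := atom_graph adj3 conn3 graph_ok3.

Definition adj4 : atom -> atom -> bool :=
  Eval vm_compute in tab (fun i => tab (block_adj (chain 3) i)).

Definition conn4 : atom -> atom -> link atom :=
  Eval vm_compute in tab (fun i => tab (block_conn (chain 3) i)).

Lemma graph_ok4 : graph_ok adj4 conn4 = true.
Proof. vm_compute; reflexivity. Qed.

Definition graph4 : graph := atom_graph adj4 conn4 graph_ok4.

Definition adj5 : atom -> atom -> bool :=
  Eval vm_compute in tab (fun i => tab (block_adj (chain 4) i)).

Definition conn5 : atom -> atom -> link atom :=
  Eval vm_compute in tab (fun i => tab (block_conn (chain 4) i)).

Lemma graph_ok5 : graph_ok adj5 conn5 = true.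
Proof. vm_compute; reflexivity. Qed.

Definition graph5 : graph := atom_graph adj5 conn5 graph_ok5.

Lemma nOA_greechie n ad co ok (G := atom_graph ad co ok) (L := greechie G) :
  3 <= n ->
  forallb (fun c : L =>
    check (L := L) (eltle G) (n - 3)
      (table0 (L := L) (eltle G) (map (point (L := L) c) (elts G atoms))))
    (elts G atoms) = true ->
  nOA n L.
Proof.
intro Hn. apply (nOA_check (L := L)); [| | exact Hn].
- intros x y. apply (elt_meet_eq G).
- apply (in_elts G), in_atoms.
Qed.

(** Position [i] of [l] is $a_i$; position 0 is a filler, as the law starts at $a_1$. *)
Lemma not_nOA n (L : ortholattice) (l : list L) (a := fun i => nth i l zero) :
  ~ le (meet (imp (a 1) (a 3)) (equivn n a)) (imp (a 2) (a 3)) -> ~ nOA n L.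
Proof. intros H K. exact (H (K a)). Qed.

(** At depth 0 only [base] itself is tested, for each value c of $a_3$. *)
Lemma nOA3 : nOA 3 (greechie graph3).
Proof. apply nOA_greechie; [lia |]. vm_cast_no_check (eq_refl true). Qed.

Lemma nOA4 : nOA 4 (greechie graph4).
Proof. apply nOA_greechie; [lia |]. vm_cast_no_check (eq_refl true). Qed.

Lemma nOA5 : nOA 5 (greechie graph5).
Proof. apply nOA_greechie; [lia |]. vm_cast_no_check (eq_refl true). Qed.

Lemma not_nOA4 : ~ nOA 4 (greechie graph3).
Proof.
(* Writing i for atom i: $c=3'$, $E(2,1)=6$, $E(2,0)=10'$ and $E(1,0)=13'$. Since $10'\cap13'=16$
   and $6\cup16=1$, the law would give $2'\le1'$. *)
apply (not_nOA 4 (greechie graph3)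
  [Bot _; At graph3 a2; At graph3 a1; Co graph3 a3; At graph3 a0]).
vm_compute; discriminate.
Qed.

Lemma not_nOA5 : ~ nOA 5 (greechie graph4).
Proof.
(* The chain is 2, 8, 14, 20 with $c=0'$: its ends are $a_1,a_2$, its interior is $a_4,a_5$. Here
   $w=1$ and $r=5$ as atoms, and their join is the top, so the law would give $2'\le20'$. *)
apply (not_nOA 5 (greechie graph4)
  [Bot _; At graph4 a2; At graph4 a20; Co graph4 a0; At graph4 a8; At graph4 a14]).
vm_compute; discriminate.
Qed.

Lemma not_nOA6 : ~ nOA 6 (greechie graph5).
Proof.
(* The same with the chain 2, 8, 14, 20, 26. *)
apply (not_nOA 6 (greechie graph5)
  [Bot _; At graph5 a2; At graph5 a26; Co graph5 a0; At graph5 a8; At graph5 a14; At graph5 a20]).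
vm_compute; discriminate.
Qed.

Lemma example n ad co ok (L := greechie (atom_graph ad co ok)) :
  nOA n L -> ~ nOA (n + 1) L ->
  exists L : ortholattice,
    finite_ol L /\ orthomodular L /\ nOA n L /\ ~ nOA (n + 1) L.
Proof.
intros H K. exists L. split; [| split; [apply greechie_orthomodular | auto]].
exists (elts (atom_graph ad co ok) atoms). apply (in_elts (atom_graph ad co ok)), in_atoms.
Qed.

Theorem theorem4p5 :
  (forall n : nat, 3 < n ->
     forall L : ortholattice, nOA n L -> nOA (n - 1) L) /\
  (forall n : nat, 3 <= n <= 5 ->
     exists L : ortholattice,
       finite_ol L /\ orthomodular L /\ nOA n L /\ ~ nOA (n + 1) L).
Proof.
split.
- intros n Hn L. apply nOA_pred, Hn.
- intros n Hn. assert (n = 3 \/ n = 4 \/ n = 5) as [-> | [-> | ->]] by lia.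
  + exact (example 3 _ _ _ nOA3 not_nOA4).
  + exact (example 4 _ _ _ nOA4 not_nOA5).
  + exact (example 5 _ _ _ nOA5 not_nOA6).
Qed.
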